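(* Let $\mathcal R$ be a left-linear and left-value-free LCTRS and let $\Pi X.\,s\,[\exists\vec{x}.\varphi]$ be an existentially constrained term. Then $\Pi X.\,s\,[\exists\vec{x}.\varphi]$ is a normal form with respect to $\leadsto_{\mathcal R}$ (i.e. there is no existentially constrained term $B$ with $\Pi X.\,s\,[\exists\vec{x}.\varphi]\leadsto_{\mathcal R}B$) if and only if every $u\in[\![\Pi X.\,s\,[\exists\vec{x}.\varphi]]\!]_{\mathsf v}$ is a normal form with respect to $\to_{[\![\mathcal R]\!]}$.
   Context: Terms are built over a sorted signature whose function symbols are split into theory symbols (whose argument and result sorts are theory sorts) and term symbols, and a set $\mathcal{V}$ of sorted variables; theory sorts and symbols are interpreted in a fixed model $\mathcal{M}$. Every element of the interpretation of each theory sort is a constant symbol, called a value; $\mathcal{V}al$ denotes the set of values. There is a theory sort of Booleans with standard interpretation and the usual connectives. A constraint is a Boolean-sorted term built from theory symbols and variables; a (possibly existentially quantified) formula is valid if it is true under all valuations of its free variables in $\mathcal{M}$ and satisfiable if true under some. $\mathcal{V}ar(\cdot)$ is the set of variables. A substitution $\sigma$ is a sort-preserving map from variables to terms with finite domain $\mathcal{D}om(\sigma)=\{x\mid \sigma(x)\neq x\}$; $\mathcal{V}Dom(\sigma)=\{x\mid\sigma(x)\in\mathcal{V}al\}$; $\sigma$ is $X$-valued if $\sigma(X)\subseteq\mathcal{V}al$. An existential constraint $\exists\vec{x}.\varphi$ is a sequence of variables $\vec x$ together with a constraint $\varphi$ with $\{\vec x\}\subseteq\mathcal{V}ar(\varphi)$;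 its free variables are $\mathcal{FV}ar(\exists\vec x.\varphi)=\mathcal{V}ar(\varphi)\setminus\{\vec x\}$. For a substitution $\sigma$, $\sigma\vDash_{\mathcal M}\exists\vec x.\varphi$ means $\sigma$ is $\mathcal{FV}ar(\exists\vec x.\varphi)$-valued and $(\exists\vec x.\varphi)\sigma$ is valid. An existentially constrained term $\Pi X.\,s\,[\exists\vec x.\varphi]$ consists of a set $X$ of variables, a term $s$ and an existential constraint with $\mathcal{FV}ar(\exists\vec x.\varphi)\subseteq X\subseteq\mathcal{V}ar(s)$ and $\{\vec x\}\cap\mathcal{V}ar(s)=\emptyset$; it is satisfiable if $\exists\vec x.\varphi$ is satisfiable. A constrained rewrite rule $\rho\colon \Pi Z.\,\ell\to r\,[\pi]$ consists of a set $Z$ of variables, terms $\ell,r$ of the same sort and a constraint $\pi$ with $\mathcal{V}ar(\pi)\cup(\mathcal{V}ar(r)\setminus\mathcal{V}ar(\ell))\subseteq Z$; it is left-linear if $\ell$ is linear and left-value-free if $\ell$ contains no values; $\mathcal{E}x\mathcal{V}ar(\rho)=\mathcal{V}ar(r)\setminus\mathcal{V}ar(\ell)$. Let $\Pi X.\,s\,[\exists\vec x.\varphi]$ be satisfiable, $\rho$ left-linear with $\mathcal{V}ar(\rho)\cap\mathcal{V}ar(s,\varphi)=\emptyset$, and $\{\vec z\}=\mathcal{V}ar(\pi)\setminus\mathcal{V}ar(\ell)$. The term has a partial $\rho$-redex at position $p$ of $s$ using $\gamma$ if (i) $\mathcal{D}om(\gamma)=\mathcal{V}ar(\ell)$, (ii)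 $s|_p=\ell\gamma$, (iii) $\gamma(x)\in\mathcal{V}al\cup X$ for all $x\in\mathcal{V}ar(\ell)\cap Z$, and (iv') $(\exists\vec x.\varphi)\wedge(\exists\vec z.\pi\gamma)$ is satisfiable; then, with $t=s[r\gamma]_p$, $\psi=\varphi\wedge\pi\gamma$, $\{\vec y\}=\mathcal{V}ar(\psi)\setminus\mathcal{V}ar(t)$, $Y=\mathcal{E}x\mathcal{V}ar(\rho)\cup(X\cap\mathcal{V}ar(t))$, there is a partial rewrite step $\Pi X.\,s\,[\exists\vec x.\varphi]\leadsto^p_{\rho,\gamma}\Pi Y.\,t\,[\exists\vec y.\psi]$. (Only satisfiable constrained terms can be rewritten.) One writes $\leadsto_\rho$ if such a step exists for some position, some $\gamma$ and some renamed variant of $\rho$ whose variables are disjoint from those of the source term. An LCTRS $\mathcal R$ is a set of left-linear constrained rewrite rules (including the calculation rules for theory symbols); it is left-value-free if all its rules are; $\leadsto_{\mathcal R}=\bigcup_{\rho\in\mathcal R}\leadsto_\rho$. For a set $R$ of pairs of ordinary terms, $u\to^p_R v$ means there are $\langle l,r'\rangle\in R$ and a substitution $\theta$ with $u|_p=l\theta$ and $v=u[r'\theta]_p$; $\to_R$ is the union over all positions; $u$ is a normal form w.r.t. $\to_R$ if there is no $v$ with $u\to_R v$. Interpretation of a rule $\rho\colon\Pi Z.\,\ell\to r\,[\pi]$: $[\![\rho]\!]=\{\langle\ell\sigma,r\sigma\rangle\mid\mathcal{D}om(\sigma)=\mathcal{V}Dom(\sigma)=Z\cap\mathcal{V}ar(\ell,r),\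 \sigma\vDash_{\mathcal M}\exists\vec z'.\pi\}$ where $\{\vec z'\}=\mathcal{V}ar(\pi)\setminus\mathcal{V}ar(\ell,r)$; $[\![\mathcal R]\!]=\bigcup_{\rho\in\mathcal R}[\![\rho]\!]$. Value interpretation: $[\![\Pi X.\,s\,[\exists\vec x.\varphi]]\!]_{\mathsf v}$ is the set of all terms $s\sigma$ where $\sigma$ is a substitution such that $\sigma(X)\subseteq\mathcal{V}al$, $\sigma(\mathcal{V}ar(s)\setminus X)\subseteq\mathcal V$, $\sigma(x)\neq\sigma(y)$ for distinct $x,y\in\mathcal{V}ar(s)\setminus X$, and $\sigma\vDash_{\mathcal M}\exists\vec x.\varphi$.
   Formalization: The sets X of constrained terms and Z of rules are required to contain only variables of theory sorts; otherwise, e.g., X={x} with x of non-theory sort and s=f(x) has an empty value interpretation although a rule f(y)→a gives a partial step. *)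

(* Defs.v *)
From HB Require Import structures.
From mathcomp Require Import ssreflect ssrfun ssrbool eqtype ssrnat seq.
From mathcomp Require Import boolp classical_sets.

Set Implicit Arguments.
Unset Strict Implicit.
Unset Printing Implicit Defensive.

Local Open Scope classical_set_scope.

(* A sorted signature, its variables and the fixed model of the theory part.
   Values are constant symbols, and the carrier of a theory sort tau is the set
   of the values of sort tau; so [interp f] acts on sequences of values. *)
Record signature := Signature {
  srt : eqType;
  sym : eqType;
  var : eqType;
  vsort : var -> srt;
  arity : sym -> seq srt;
  res : sym -> srt;
  th_sort : pred srt;
  th_sym : pred sym;
  is_val : pred sym;
  interp : sym -> seq sym -> sym;
  sbool : srt;
  bval : bool -> sym;
  s_not : sym;
  s_and : sym;
  s_or : sym;
  s_imp : sym;
  s_iff : sym;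
  var_infinite : forall (tau : srt) (xs : seq var),
    exists x, vsort x = tau /\ x \notin xs;
  th_sym_sorts : forall f, th_sym f -> all th_sort (arity f) && th_sort (res f);
  val_th : forall c, is_val c -> th_sym c;
  val_const : forall c, is_val c -> arity c = [::];
  carrier_nonempty : forall tau, th_sort tau ->
    exists c, is_val c /\ res c = tau;
  interp_sort : forall f vs, th_sym f ->
    all is_val vs -> map res vs = arity f ->
    is_val (interp f vs) /\ res (interp f vs) = res f;
  interp_val : forall c, is_val c -> interp c [::] = c;
  sbool_th : th_sort sbool;
  bval_inj : injective bval;
  bvalP : forall c, (is_val c /\ res c = sbool) <-> exists b, c = bval b;
  s_not_th : [/\ th_sym s_not, arity s_not = [:: sbool] & res s_not = sbool];
  s_and_th :
    [/\ th_sym s_and, arity s_and = [:: sbool; sbool] & res s_and = sbool];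
  s_or_th :
    [/\ th_sym s_or, arity s_or = [:: sbool; sbool] & res s_or = sbool];
  s_imp_th :
    [/\ th_sym s_imp, arity s_imp = [:: sbool; sbool] & res s_imp = sbool];
  s_iff_th :
    [/\ th_sym s_iff, arity s_iff = [:: sbool; sbool] & res s_iff = sbool];
  interp_not : forall a, interp s_not [:: bval a] = bval (~~ a);
  interp_and : forall a b, interp s_and [:: bval a; bval b] = bval (a && b);
  interp_or : forall a b, interp s_or [:: bval a; bval b] = bval (a || b);
  interp_imp : forall a b, interp s_imp [:: bval a; bval b] = bval (a ==> b);
  interp_iff : forall a b, interp s_iff [:: bval a; bval b] = bval (a == b)
}.

Inductive term (S : signature) : Type :=
| Var of var S
| App of sym S & seq (term S).

Arguments Var {S}.
Arguments App {S}.

(* [None] on ill-sorted raw terms *)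
Fixpoint sort_of (S : signature) (t : term S) : option (srt S) :=
  match t with
  | Var x => Some (vsort x)
  | App f ts =>
      if [seq sort_of u | u <- ts] == [seq Some tau | tau <- arity f]
      then Some (res f) else None
  end.

Fixpoint vars (S : signature) (t : term S) : seq (var S) :=
  match t with
  | Var x => [:: x]
  | App _ ts => flatten [seq vars u | u <- ts]
  end.

Definition linear (S : signature) (t : term S) : bool := uniq (vars t).

Fixpoint value_free (S : signature) (t : term S) : bool :=
  match t with
  | Var _ => true
  | App f ts => ~~ is_val f && all (@value_free S) ts
  end.

Definition value (S : signature) (t : term S) : Prop :=
  exists2 c, is_val c & t = App c [::].

Fixpoint th_term (S : signature) (t : term S) : bool :=
  match t with
  | Var _ => true
  | App f ts => th_sym f && all (@th_term S) ts
  end.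

Definition constraint (S : signature) (phi : term S) : Prop :=
  th_term phi /\ sort_of phi = Some (sbool S).

Definition theory_vars (S : signature) : set (var S) :=
  [set x | th_sort (vsort x)].

Fixpoint subterm (S : signature) (t : term S) (p : seq nat) : option (term S) :=
  match p, t with
  | [::], _ => Some t
  | i :: q, App _ ts => if onth ts i is Some u then subterm u q else None
  | _ :: _, Var _ => None
  end.

(* t[u]_p; only meaningful at positions p of t *)
Fixpoint replace (S : signature) (t : term S) (p : seq nat) (u : term S) :
    term S :=
  match p, t with
  | [::], _ => u
  | i :: q, App f ts =>
      if onth ts i is Some w then App f (set_nth w ts i (replace w q u)) else t
  | _ :: _, Var _ => t
  end.

Fixpoint app_subst (S : signature) (sigma : var S -> term S) (t : term S) :
    term S :=
  match t with
  | Var x => sigma x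
  | App f ts => App f [seq app_subst sigma u | u <- ts]
  end.

Definition Dom (S : signature) (sigma : var S -> term S) : set (var S) :=
  [set x | sigma x <> Var x].

Definition VDom (S : signature) (sigma : var S -> term S) : set (var S) :=
  [set x | value (sigma x)].

Record substitution (S : signature) := Substitution {
  sfun :> var S -> term S;
  sfun_sort : forall x, sort_of (sfun x) = Some (vsort x);
  sfun_fin : exists xs : seq (var S), Dom sfun `<=` [set` xs]
}.

Definition valued (S : signature) (X : set (var S)) (sigma : var S -> term S) :
    Prop :=
  X `<=` VDom sigma.

(* Only the theory-sorted variables need sensible values: no other variable
   occurs in a constraint. *)
Definition valuation (S : signature) (alpha : var S -> sym S) : Prop :=
  forall x, theory_vars x -> is_val (alpha x) /\ res (alpha x) = vsort x.

Fixpoint eval (S : signature) (alpha : var S -> sym S) (t : term S) : sym S :=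
  match t with
  | Var x => alpha x
  | App f ts => interp f [seq eval alpha u | u <- ts]
  end.

Inductive formula (S : signature) : Type :=
| FCon of term S
| FAnd of formula S & formula S
| FEx of seq (var S) & formula S.

Arguments FCon {S}.
Arguments FAnd {S}.
Arguments FEx {S}.

Fixpoint holds (S : signature) (alpha : var S -> sym S) (F : formula S) : Prop :=
  match F with
  | FCon phi => eval alpha phi = bval S true
  | FAnd F1 F2 => holds alpha F1 /\ holds alpha F2
  | FEx xs G => exists beta, [/\ valuation beta,
      forall x, x \notin xs -> beta x = alpha x & holds beta G]
  end.

Definition valid (S : signature) (F : formula S) : Prop :=
  forall alpha, valuation alpha -> holds alpha F.

Definition satisfiable (S : signature) (F : formula S) : Prop :=
  exists2 alpha, valuation alpha & holds alpha F.

(* Bound variables are not renamed: [models] only uses [fsubst] with free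
   variables mapped to values, so no capture can occur. *)
Fixpoint fsubst (S : signature) (sigma : var S -> term S) (F : formula S) :
    formula S :=
  match F with
  | FCon phi => FCon (app_subst sigma phi)
  | FAnd F1 F2 => FAnd (fsubst sigma F1) (fsubst sigma F2)
  | FEx xs G =>
      FEx xs (fsubst (fun x => if x \in xs then Var x else sigma x) G)
  end.

Record exconstraint (S : signature) := ExConstraint {
  bvars : seq (var S);
  body : term S;
  body_constraint : constraint body;
  bvars_sub : {subset bvars <= vars body}
}.

Definition FVar (S : signature) (c : exconstraint S) : set (var S) :=
  [set` vars (body c)] `\` [set` bvars c].

Definition formula_of (S : signature) (c : exconstraint S) : formula S :=
  FEx (bvars c) (FCon (body c)).

Definition models (S : signature) (sigma : var S -> term S)
    (c : exconstraint S) : Prop :=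
  valued (FVar c) sigma /\ valid (fsubst sigma (formula_of c)).

(* Pi X. s [exists xs. phi] *)
Record ecterm (S : signature) := EcTerm {
  ecX : set (var S);
  ecs : term S;
  ecc : exconstraint S;
  ecX_theory : ecX `<=` @theory_vars S;
  ecs_sorted : sort_of ecs <> None;
  ecX_lower : FVar ecc `<=` ecX;
  ecX_upper : ecX `<=` [set` vars ecs];
  ec_bound : [set` bvars ecc] `&` [set` vars ecs] = set0
}.

Definition ec_satisfiable (S : signature) (A : ecterm S) : Prop :=
  satisfiable (formula_of (ecc A)).

(* Pi Z. l -> r [pi] *)
Record crule (S : signature) := CRule {
  ruleZ : set (var S);
  lhs : term S;
  rhs : term S;
  rulec : term S;
  ruleZ_theory : ruleZ `<=` @theory_vars S;
  rule_sorted : exists tau, sort_of lhs = Some tau /\ sort_of rhs = Some tau;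
  rulec_constraint : constraint rulec;
  ruleZ_lower :
    [set` vars rulec] `|` ([set` vars rhs] `\` [set` vars lhs]) `<=` ruleZ
}.

(* Elements of Z that occur nowhere in l, r, pi are irrelevant; as Z may be
   infinite, counting them here could leave a rule without fresh variants. *)
Definition rule_vars (S : signature) (rho : crule S) : set (var S) :=
  [set` vars (lhs rho)] `|` [set` vars (rhs rho)] `|` [set` vars (rulec rho)].

Definition ExVar (S : signature) (rho : crule S) : set (var S) :=
  [set` vars (rhs rho)] `\` [set` vars (lhs rho)].

Definition left_linear (S : signature) (rho : crule S) : Prop :=
  linear (lhs rho).

Definition left_value_free (S : signature) (rho : crule S) : Prop :=
  value_free (lhs rho).

Definition rename (S : signature) (delta : var S -> var S) : term S -> term S :=
  app_subst (fun x => Var (delta x)).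

Definition variant (S : signature) (rho rho' : crule S) : Prop :=
  exists delta : var S -> var S,
    [/\ bijective delta, forall x, vsort (delta x) = vsort x,
        ruleZ rho' = delta @` ruleZ rho
      & [/\ lhs rho' = rename delta (lhs rho),
            rhs rho' = rename delta (rhs rho)
          & rulec rho' = rename delta (rulec rho)]].

Definition equality_sym (S : signature) (tau : srt S) (e : sym S) : Prop :=
  [/\ th_sym e, arity e = [:: tau; tau], res e = sbool S
    & forall a b, is_val a -> res a = tau -> is_val b -> res b = tau ->
        interp e [:: a; b] = bval S (a == b)].

(* Pi {x1,..,xn,y}. f(x1,..,xn) -> y [y = f(x1,..,xn)] *)
Definition calculation_rule (S : signature) (f : sym S) (rho : crule S) : Prop :=
  exists (xs : seq (var S)) (y : var S) (e : sym S),
    let fxs := App f [seq Var x | x <- xs] in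
    [/\ uniq (y :: xs), [seq vsort x | x <- xs] = arity f, vsort y = res f,
        equality_sym (res f) e
      & [/\ ruleZ rho = [set` y :: xs], lhs rho = fxs, rhs rho = Var y
          & rulec rho = App e [:: Var y; fxs]]].

Definition lctrs (S : signature) (R : set (crule S)) : Prop :=
  (forall rho, R rho -> left_linear rho) /\
  (forall f, th_sym f -> ~~ is_val f ->
     exists2 rho, R rho & calculation_rule f rho).

Record partial_redex (S : signature) (A : ecterm S) (rho : crule S)
    (p : seq nat) (gamma : substitution S) : Prop := PartialRedex {
  pr_sat : ec_satisfiable A;
  pr_linear : left_linear rho;
  pr_disjoint :
    rule_vars rho `&` ([set` vars (ecs A)] `|` [set` vars (body (ecc A))]) =
    set0;
  pr_dom : Dom gamma = [set` vars (lhs rho)];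
  pr_match : subterm (ecs A) p = Some (app_subst gamma (lhs rho));
  pr_Z : forall x, x \in vars (lhs rho) -> ruleZ rho x ->
    value (gamma x) \/ (exists2 y, ecX A y & gamma x = Var y);
  (* no capture: the variables zs are neither moved nor introduced by gamma *)
  pr_constraint :
    let zs := [seq z <- vars (rulec rho) | z \notin vars (lhs rho)] in
    satisfiable (FAnd (formula_of (ecc A))
                      (FEx zs (FCon (app_subst gamma (rulec rho)))))
}.

Definition partial_step_at (S : signature) (rho : crule S) (p : seq nat)
    (gamma : substitution S) (A B : ecterm S) : Prop :=
  let t := replace (ecs A) p (app_subst gamma (rhs rho)) in
  let psi := App (s_and S) [:: body (ecc A); app_subst gamma (rulec rho)] in
  [/\ partial_redex A rho p gamma,
      ecX B = ExVar rho `|` (ecX A `&` [set` vars t]),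
      ecs B = t,
      body (ecc B) = psi
    & [set` bvars (ecc B)] = [set` vars psi] `\` [set` vars t]].

Definition partial_step (S : signature) (R : set (crule S)) (A B : ecterm S) :
    Prop :=
  exists rho rho' p gamma,
    [/\ R rho, variant rho rho' & partial_step_at rho' p gamma A B].

Definition rstep (S : signature) (R : set (term S * term S)) (u v : term S) :
    Prop :=
  exists l r p (theta : substitution S),
    [/\ R (l, r), subterm u p = Some (app_subst theta l)
      & v = replace u p (app_subst theta r)].

Definition rule_interp (S : signature) (rho : crule S) :
    set (term S * term S) :=
  [set lr | exists (sigma : substitution S) (c : exconstraint S),
    [/\ Dom sigma = VDom sigma,
        VDom sigma =
          ruleZ rho `&` ([set` vars (lhs rho)] `|` [set` vars (rhs rho)]),
        body c = rulec rho /\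
        [set` bvars c] = [set` vars (rulec rho)] `\`
          ([set` vars (lhs rho)] `|` [set` vars (rhs rho)]),
        models sigma c
      & lr = (app_subst sigma (lhs rho), app_subst sigma (rhs rho))]].

Definition lctrs_interp (S : signature) (R : set (crule S)) :
    set (term S * term S) :=
  \bigcup_(rho in R) rule_interp rho.

Definition value_interp (S : signature) (A : ecterm S) : set (term S) :=
  [set u | exists sigma : substitution S,
    let W := [set` vars (ecs A)] `\` ecX A in
    [/\ valued (ecX A) sigma,
        (forall x, W x -> exists y, sigma x = Var y),
        (forall x y, W x -> W y -> x <> y -> sigma x <> sigma y),
        models sigma (ecc A)
      & u = app_subst sigma (ecs A)]].

Definition normal_form (T : Type) (step : T -> T -> Prop) (a : T) : Prop :=
  ~ exists b, step a b.

(* Main.v *)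
Require Import Defs.
From mathcomp Require Import ssreflect ssrfun ssrbool eqtype ssrnat seq.
From mathcomp Require Import boolp classical_sets.

(* Applying [[rho]] to u at p amounts to giving a matcher eta of the left-hand
   side and a valuation beta of all rule variables that satisfies the constraint
   and agrees with eta on the logical variables; this description is stable under
   renaming rho. A valuation witnessing the satisfiability condition of a partial
   redex yields an instance of s in the value interpretation together with such
   data. Conversely, an instance s sigma only puts values and variables below the
   function symbols of s, so a linear value-free left-hand side matching a subterm
   of s sigma already matches the corresponding subterm of s, and sigma glued with
   beta witnesses satisfiability. *)

Set Implicit Arguments.
Unset Strict Implicit.
Unset Printing Implicit Defensive.

Local Open Scope classical_set_scope.

(** * Substitution and evaluation on terms *)

Section Terms.
Variable S : signature.
Implicit Types (t u w : term S) (f g : var S -> term S) (a b : var S -> sym S).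

(** Terms nest through lists, so the generated induction principle gives no hypothesis on arguments;
    [Q] carries the claim along argument lists. *)
Lemma term_seq_ind (Q : seq (term S) -> Prop) (P : term S -> Prop) :
  (forall x, P (Var x)) -> (forall c ts, Q ts -> P (App c ts)) ->
  Q [::] -> (forall t ts, P t -> Q ts -> Q (t :: ts)) ->
  forall t, P t.
Proof.
move=> PV PA Q0 QS; fix IH 1; case=> [x | c ts]; first exact: PV.
apply: PA; elim: ts => [|t ts IHts]; first exact: Q0.
by apply: QS; [exact: IH | exact: IHts].
Qed.

Lemma eq_in_app_subst f g t :
  {in vars t, f =1 g} -> app_subst f t = app_subst g t.
Proof.
elim/(term_seq_ind (Q := fun ts => {in flatten (map (@vars S) ts), f =1 g} ->
  map (app_subst f) ts = map (app_subst g) ts)): t => //=.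
- by move=> x; apply; rewrite inE.
- by move=> c ts IH /IH ->.
move=> t ts IHt IHts fg; rewrite IHt ?IHts // => x xt; apply: fg;
  by rewrite mem_cat xt ?orbT.
Qed.

(** Substitution keeps the function symbols in place, so two equal instances of one term can be
    compared leaf by leaf. *)
Lemma app_subst_inj_in f g t :
  app_subst f t = app_subst g t -> {in vars t, f =1 g}.
Proof.
elim/(term_seq_ind (Q := fun ts =>
  map (app_subst f) ts = map (app_subst g) ts ->
  {in flatten (map (@vars S) ts), f =1 g})): t => //=.
- by move=> x fg y; rewrite inE => /eqP ->.
- by move=> c ts IH [/IH].
move=> t ts IHt IHts [/IHt ht /IHts hts] x; rewrite mem_cat => /orP[].
  exact: ht.
exact: hts.
Qed.

Lemma app_substA f g t :
  app_subst f (app_subst g t) = app_subst (fun x => app_subst f (g x)) t.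
Proof.
elim/(term_seq_ind (Q := fun ts => map (app_subst f) (map (app_subst g) ts) =
  map (app_subst (fun x => app_subst f (g x))) ts)): t => //=.
  by move=> c ts ->.
by move=> t ts -> ->.
Qed.

Lemma eval_app_subst a f t :
  eval a (app_subst f t) = eval (fun x => eval a (f x)) t.
Proof.
elim/(term_seq_ind (Q := fun ts => map (eval a) (map (app_subst f) ts) =
  map (eval (fun x => eval a (f x))) ts)): t => //=.
  by move=> c ts ->.
by move=> t ts -> ->.
Qed.

Lemma eq_in_eval a b t : {in vars t, a =1 b} -> eval a t = eval b t.
Proof.
elim/(term_seq_ind (Q := fun ts => {in flatten (map (@vars S) ts), a =1 b} ->
  map (eval a) ts = map (eval b) ts)): t => //=.
- by move=> x; apply; rewrite inE.
- by move=> c ts IH /IH ->.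
move=> t ts IHt IHts fg; rewrite IHt ?IHts // => x xt; apply: fg;
  by rewrite mem_cat xt ?orbT.
Qed.

Lemma eval_value a c : is_val c -> eval a (App c [::]) = c.
Proof. by move=> c_val; rewrite /= interp_val. Qed.

Lemma sort_of_value (c : sym S) : is_val c -> sort_of (App c [::]) = Some (res c).
Proof. by move=> c_val; rewrite /= (val_const c_val). Qed.

Lemma sort_of_app_subst f t :
  {in vars t, forall x, sort_of (f x) = Some (vsort x)} ->
  sort_of (app_subst f t) = sort_of t.
Proof.
elim/(term_seq_ind (Q := fun ts => {in flatten (map (@vars S) ts),
  forall x, sort_of (f x) = Some (vsort x)} ->
  map (@sort_of S) (map (app_subst f) ts) = map (@sort_of S) ts)): t => //=.
- by move=> x; apply; rewrite inE.
- by move=> c ts IH /IH ->.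
move=> t ts IHt IHts fg; rewrite IHt ?IHts // => x xt; apply: fg;
  by rewrite mem_cat xt ?orbT.
Qed.

Lemma th_term_app_subst f t :
  th_term t -> {in vars t, forall x, th_term (f x)} -> th_term (app_subst f t).
Proof.
elim/(term_seq_ind (Q := fun ts => all (@th_term S) ts ->
  {in flatten (map (@vars S) ts), forall x, th_term (f x)} ->
  all (@th_term S) (map (app_subst f) ts))): t => //=.
- by move=> x _; apply; rewrite inE.
- by move=> c ts IH /andP[-> /IH h] /h ->.
move=> t ts IHt IHts /andP[/IHt ht /IHts hts] fg; rewrite ht ?hts // => x xt;
  by apply: fg; rewrite mem_cat xt ?orbT.
Qed.

Lemma vars_app_subst f t :
  vars (app_subst f t) = flatten [seq vars (f x) | x <- vars t].
Proof.
elim/(term_seq_ind (Q := fun ts =>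
  flatten (map (@vars S) (map (app_subst f) ts)) =
  flatten [seq vars (f x) | x <- flatten (map (@vars S) ts)])): t => //=.
  by move=> x; rewrite cats0.
by move=> t ts -> ->; rewrite map_cat flatten_cat.
Qed.

Lemma mem_vars_app_subst f t y :
  reflect (exists2 x, x \in vars t & y \in vars (f x))
          (y \in vars (app_subst f t)).
Proof. by rewrite vars_app_subst; exact: flatten_mapP. Qed.

Lemma vars_rename (d : var S -> var S) t : vars (rename d t) = map d (vars t).
Proof.
by rewrite vars_app_subst; elim: (vars t) => //= x xs ->.
Qed.

Lemma value_free_rename (d : var S -> var S) t :
  value_free (rename d t) = value_free t.
Proof.
rewrite /rename.
elim/(term_seq_ind (Q := fun ts =>
  all (@value_free S) (map (rename d) ts) = all (@value_free S) ts)): t => //=.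
  by move=> c ts ->.
by move=> t ts -> ->.
Qed.

(** * Positions, replacement and matching *)

Lemma mem_vars_onth ts i w x :
  onth ts i = Some w -> x \in vars w -> x \in flatten (map (@vars S) ts).
Proof.
elim: ts i => [|t ts IH] [|i] //=; rewrite mem_cat; first by move=> [->] ->.
by move=> /IH h /h ->; rewrite orbT.
Qed.

Lemma vars_subterm t p w : subterm t p = Some w -> {subset vars w <= vars t}.
Proof.
elim: p t => [|i p IH] [y|c ts] //=; try by move=> [<-].
case ti: (onth ts i) => [u|] // /IH sub x /sub; exact: mem_vars_onth ti.
Qed.

Lemma subterm_app_subst f t p w :
  subterm t p = Some w ->
  subterm (app_subst f t) p = Some (app_subst f w).
Proof.
elim: p t => [|i p IH] [y|c ts] //=; try by move=> [<-].
by rewrite onth_map; case: (onth ts i) => //= u /IH.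
Qed.

Lemma sort_of_replace t p w u :
  subterm t p = Some w -> sort_of u = sort_of w ->
  sort_of (replace t p u) = sort_of t.
Proof.
move=> tp uw; elim: p t tp => [|i p IH] t; first by case=> ->.
case: t => [y|c ts] //=.
case ti: (onth ts i) => [v|] // vp /=.
suff -> : map (@sort_of S) (set_nth v ts i (replace v p u)) =
          map (@sort_of S) ts by [].
elim: ts i ti => [|t ts IHts] [|i] //=; last by move=> /IHts ->.
by move=> [->]; rewrite IH.
Qed.

Lemma vars_replace t p u x :
  x \in vars (replace t p u) -> x \in vars t \/ x \in vars u.
Proof.
elim: p t => [|i p IH] [y|c ts] //=; try by [left | right].
case ti: (onth ts i) => [v|] /=; last by left.
elim: ts i ti => [|t ts IHts] [|i] //=.
  move=> [->]; rewrite !mem_cat => /orP[/IH [->|->]|->]; rewrite ?orbT;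
    by [left|right].
move=> /IHts h; rewrite !mem_cat => /orP[->|/h[->|->]]; rewrite ?orbT;
  by [left|right].
Qed.

Lemma vars_replace_sub t p u w :
  subterm t p = Some w -> {subset vars u <= vars (replace t p u)}.
Proof.
move=> tp x xu; elim: p t tp => [|i p IH] [y|c ts] //=.
case ti: (onth ts i) => [v|] // /IH xv /=.
elim: ts i ti => [|t ts IHts] [|i] //=; rewrite mem_cat; first by rewrite xv.
by move=> /IHts ->; rewrite orbT.
Qed.

(** Resetting [f] to the identity off a list provides the finite domain that [substitution]
    demands. *)
Lemma exists_substitution (xs : seq (var S)) f :
  {in xs, forall x, sort_of (f x) = Some (vsort x)} ->
  exists s : substitution S, forall x, s x = if x \in xs then f x else Var x.
Proof.
move=> fsort; pose g x := if x \in xs then f x else Var x.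
have gsort x : sort_of (g x) = Some (vsort x).
  by rewrite /g; case: ifP => // /fsort.
have gfin : exists xs : seq (var S), Dom g `<=` [set` xs].
  by exists xs => x; rewrite /Dom /g /=; case: ifP.
by exists (Substitution gsort gfin).
Qed.

Lemma exists_valuation : exists a : var S -> sym S, valuation a.
Proof.
have /choice [a aP] : forall x : var S, exists c,
    theory_vars x -> is_val c /\ res c = vsort x.
  move=> x; case: (pselect (theory_vars x)) => [/carrier_nonempty[c cP] | nx].
    by exists c.
  (* A valuation is unconstrained at non-theory sorts, so any symbol serves there. *)
  by exists (s_and S).
by exists a.
Qed.

Definition var_or_value t := (exists y, t = Var y) \/ value t.

(** Variables and values have no proper subterms, so no position of the instance lies strictly
    inside some [f x]: each one is already a position of [t]. *)
Lemma subterm_app_substE f t p w :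
  {in vars t, forall x, var_or_value (f x)} ->
  subterm (app_subst f t) p = Some w ->
  exists2 w', subterm t p = Some w' & w = app_subst f w'.
Proof.
elim: p t => [|i p IH] [y|c ts] fP /=.
- by move=> [<-]; exists (Var y).
- by move=> [<-]; exists (App c ts).
- have [[z ->]|[c _ ->]] // := fP y (mem_head _ _).
  by case: i.
rewrite onth_map; case ti: (onth ts i) => [v|] //=; apply: IH => x xv.
exact: fP (mem_vars_onth ti xv).
Qed.

(* Value-freeness forbids a function symbol of [l] from meeting a value put
   into [t] by [f]; linearity glues the matchers of the arguments of [l]. *)
Lemma value_free_match f g (l : term S) :
  linear l -> value_free l -> forall t,
  {in vars t, forall x, var_or_value (f x)} ->
  app_subst f t = app_subst g l -> exists h, t = app_subst h l.
Proof.
rewrite /linear; elim/(term_seq_ind (Q := fun ls =>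
  uniq (flatten (map (@vars S) ls)) -> all (@value_free S) ls -> forall ts,
  {in flatten (map (@vars S) ts), forall x, var_or_value (f x)} ->
  map (app_subst f) ts = map (app_subst g) ls ->
  exists h, ts = map (app_subst h) ls)): l => /=.
- by move=> x _ _ t _ _; exists (fun=> t).
- move=> c ls IH ulin /andP[nc lsv] [x|d ts] fP /=.
    have [[z ->]|[d d_val ->]] // := fP x (mem_head _ _).
    by move=> [dc]; rewrite -dc d_val in nc.
  by move=> [-> /(IH ulin lsv _ fP) [h ->]]; exists h.
- by move=> _ _ [|t ts] //; exists (fun x => Var x).
move=> l ls IHl IHls; rewrite cat_uniq => /and3P[ul /hasPn dj uls] /andP[lv lsv].
case=> [|t ts] //= fP [tl tsls].
have [|h1 t_h1] := IHl ul lv t _ tl.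
  by move=> x xt; apply: fP; rewrite mem_cat xt.
have [|h2 ts_h2] := IHls uls lsv ts _ tsls.
  by move=> x xt; apply: fP; rewrite mem_cat xt orbT.
exists (fun x => if x \in vars l then h1 x else h2 x); congr cons.
  by rewrite t_h1; apply: eq_in_app_subst => x ->.
rewrite ts_h2; elim: ls {IHls lsv uls tsls ts_h2} dj => //= l' ls IH dj.
congr cons; last by apply: IH => x xls; apply: dj; rewrite mem_cat xls orbT.
apply: eq_in_app_subst => x xl'.
by rewrite ifN //; apply: dj; rewrite mem_cat xl'.
Qed.

End Terms.

(** * Rules and their interpretation *)

Section Rules.
Variable S : signature.
Implicit Types (rho : crule S) (eta : var S -> term S) (beta : var S -> sym S).

(** The existential quantifier over variables of the constraint alone is opened into [beta]. Only
    reducibility matters, so no contractum is recorded. [eta] is a raw map, well sorted on the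
    left-hand side, which makes composing it with a renaming immediate. *)
Record rule_match rho eta beta : Prop := RuleMatch {
  rm_sort : {in vars (lhs rho), forall x, sort_of (eta x) = Some (vsort x)};
  rm_val : valuation beta;
  rm_Z : forall x, x \in vars (lhs rho) -> ruleZ rho x ->
    eta x = App (beta x) [::];
  rm_constraint : eval beta (rulec rho) = bval S true
}.

Lemma substitution_value_res (s : substitution S) x c :
  is_val c -> s x = App c [::] -> res c = vsort x.
Proof.
by move=> c_val sx; move: (sfun_sort s x); rewrite sx sort_of_value // => -[].
Qed.

(** The matcher is the value assignment [s] of the interpretation followed by [theta]; the valuation
    comes from [s] and the witness of the quantified constraint. *)
Lemma rule_interp_match rho l r (theta : substitution S) :
  rule_interp rho (l, r) ->
  exists eta beta, rule_match rho eta beta /\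
    app_subst theta l = app_subst eta (lhs rho).
Proof.
move=> [s [c [domE vdomE [bodyE bvE] [_ s_valid] [-> _]]]].
have [a0 a0_val] := exists_valuation S.
have [b [b_val _ /= bT]] := s_valid _ a0_val.
(* This is the map that [fsubst] applies under the quantifier: evaluated at [b], it gives the
   witness on bound variables and the values of [s] on the free ones. *)
pose s' x := if x \in bvars c then Var x else s x.
exists (fun x => app_subst theta (s x)), (fun x => eval b (s' x)); split.
  split.
  - move=> x _; rewrite sort_of_app_subst ?sfun_sort // => y _.
    exact: sfun_sort.
  - move=> x xth; rewrite /s'; case: ifP => _; first exact: b_val.
    have [[d d_val sx]|nv] := pselect (value (s x)).
      rewrite sx eval_value //; split=> //; exact: substitution_value_res sx.
    (* As [Dom s] equals [VDom s], a variable not sent to a value is fixed. *)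
    have -> : s x = Var x; last exact: b_val.
    by apply: contrapT => sx; apply: nv; have : Dom s x by []; rewrite domE.
  - move=> x xl xZ; rewrite /s' ifN; last first.
      apply/negP => xb; have : [set` bvars c] x by [].
      by rewrite bvE => -[_]; apply; left.
    have : VDom s x by rewrite vdomE; split=> //; left.
    by move=> [d d_val ->]; rewrite /= interp_val.
  - by rewrite -bodyE -eval_app_subst.
by rewrite app_substA.
Qed.

(** On the left-hand side [eta] factors in two stages: [s] first puts the values of [beta] for the
    logical variables, then [theta] treats the others. *)
Lemma rule_match_interp rho eta beta :
  rule_match rho eta beta ->
  exists l r (theta : substitution S), rule_interp rho (l, r) /\
    app_subst theta l = app_subst eta (lhs rho).
Proof.
move=> [eta_sort beta_val etaZ betaT].
have Zval x : ruleZ rho x -> is_val (beta x) /\ res (beta x) = vsort x.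
  by move=> /ruleZ_theory /beta_val.
pose lr := vars (lhs rho) ++ vars (rhs rho).
have lrE : [set` lr] = [set` vars (lhs rho)] `|` [set` vars (rhs rho)].
  by apply/seteqP; split=> x /=; rewrite mem_cat => /orP.
(* [ruleZ] may be infinite, but only its part occurring in the two sides is instantiated. *)
pose zs := [seq x <- lr | `[< ruleZ rho x >]].
have zsP x : reflect (ruleZ rho x /\ x \in lr) (x \in zs).
  by rewrite mem_filter; apply: (iffP andP) => -[/asboolP].
have [|s sE] := @exists_substitution S zs (fun x => App (beta x) [::]).
  by move=> x /zsP[/Zval[bx <-] _]; rewrite sort_of_value.
have [|theta thetaE] := @exists_substitution S
    [seq x <- vars (lhs rho) | `[< ~ ruleZ rho x >]] eta.
  by move=> x; rewrite mem_filter => /andP[_]; exact: eta_sort.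
have DomE : Dom s = [set` zs].
  by apply/seteqP; split=> x; rewrite /Dom /= sE; case: ifP.
have VDomE : VDom s = [set` zs].
  apply/seteqP; split=> x; rewrite /VDom /= sE; case: ifP => //.
    by move=> _ [].
  by move=> /zsP[/Zval[bx _] _] _; exists (beta x).
have bvsub : {subset [seq x <- vars (rulec rho) | x \notin lr] <=
    vars (rulec rho)}.
  by move=> x; rewrite mem_filter => /andP[].
pose c := ExConstraint (rulec_constraint rho) bvsub.
exists (app_subst s (lhs rho)), (app_subst s (rhs rho)), theta; split.
  exists s, c; split=> //.
  - by rewrite DomE VDomE.
  - rewrite VDomE -lrE; apply/seteqP; split=> x /=; first by move=> /zsP[].
    by move=> ?; apply/zsP.
  - split=> //; rewrite -lrE; apply/seteqP; split=> x /=; rewrite mem_filter.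
      by move=> /andP[/negP].
    by move=> [-> /negP ->].
  split.
    move=> x /= [xc xb]; rewrite VDomE; apply/zsP; split.
      by apply: (@ruleZ_lower _ rho); left.
    by apply: contrapT => /negP xlr; apply: xb => /=; rewrite mem_filter xlr.
  move=> a a_val /=.
  (* The bound variables take their values from [beta]; every other variable of the constraint is in
     [zs], hence was already replaced by its [beta] value. *)
  exists (fun x => if x \in bvars c then beta x else a x); split.
  - by move=> x xth; case: ifP => _; [exact: beta_val | exact: a_val].
  - by move=> x /= /negbTE ->.
  rewrite /= eval_app_subst -betaT; apply: eq_in_eval => x xc.
  case: ifP => [/= -> //|]; rewrite mem_filter xc andbT => /negbFE xlr.
  have xZ : ruleZ rho x by apply: (@ruleZ_lower _ rho); left.
  rewrite sE; have -> : x \in zs by apply/zsP.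
  by rewrite /= interp_val //; have [] := Zval _ xZ.
rewrite app_substA; apply: eq_in_app_subst => x xl.
rewrite sE; case: ifP => [/zsP[xZ _]|/zsP xzs] /=; first by rewrite -etaZ.
rewrite thetaE mem_filter xl andbT asboolT // => xZ; apply: xzs; split=> //.
by rewrite mem_cat xl.
Qed.

(** * Variants and fresh renamings *)

Lemma variant_sym rho rho' : variant rho rho' -> variant rho' rho.
Proof.
move=> [d [[e de ed] dsort ZE [lE rE cE]]].
have renameK t : rename e (rename d t) = t.
  rewrite /rename app_substA -[RHS](_ : app_subst (@Var S) t = t).
    by apply: eq_in_app_subst => x _ /=; rewrite de.
  elim/(term_seq_ind (Q := fun ts => map (app_subst (@Var S)) ts = ts)): t.
  - by [].
  - by move=> c ts /= ->.
  - by [].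
  by move=> t ts /= -> ->.
exists e; split; last by rewrite lE rE cE !renameK.
- by exists d.
- by move=> x; rewrite -dsort ed.
rewrite ZE; apply/seteqP; split=> x /=.
  by move=> xZ; exists (d x); [exists x | rewrite de].
by move=> [_ [y yZ <-] <-]; rewrite de.
Qed.

(** Matcher and valuation are both precomposed with the renaming. *)
Lemma rule_match_variant rho rho' eta beta :
  variant rho rho' -> rule_match rho' eta beta ->
  exists eta' beta', rule_match rho eta' beta' /\
    app_subst eta' (lhs rho) = app_subst eta (lhs rho').
Proof.
move=> [d [_ dsort ZE [lE _ cE]]] [eta_sort beta_val etaZ betaT].
have dl x : x \in vars (lhs rho) -> d x \in vars (lhs rho').
  by move=> xl; rewrite lE vars_rename map_f.
exists (eta \o d), (beta \o d); split; last by rewrite lE /rename app_substA.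
split.
- by move=> x /dl xl /=; rewrite eta_sort // dsort.
- move=> x xth /=; rewrite -(dsort x); apply: beta_val.
  by rewrite /theory_vars /= dsort.
- by move=> x /dl xl xZ /=; apply: etaZ => //; rewrite ZE; exists x.
by rewrite -betaT cE /rename eval_app_subst.
Qed.

(** Induction on [V]: the renaming is followed by a swap of [d x] with a new variable [y] of the
    same sort. Swapping preserves bijectivity, and as [y] is outside the images of [V], the images
    already moved out of [F] stay there. *)
Lemma fresh_renaming (V F : seq (var S)) :
  exists d : var S -> var S, [/\ bijective d, forall x, vsort (d x) = vsort x
    & {in V, forall x, d x \notin F}].
Proof.
elim: V => [|x V [d [[e de ed] dsort dF]]].
  by exists id; split=> //; exists id.
have [y [ysort]] := var_infinite (vsort x) (F ++ map d (x :: V)).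
rewrite mem_cat negb_or => /andP[yF yd].
pose sw z := if z == d x then y else if z == y then d x else z.
have swK : involutive sw.
  move=> z; rewrite /sw; case: (eqVneq z (d x)) => [->|zx].
    by rewrite eqxx; case: eqP.
  by case: (eqVneq z y) => [->|zy]; rewrite ?eqxx // (negbTE zx) (negbTE zy).
exists (sw \o d); split.
- exists (e \o sw) => z /=; first by rewrite swK de.
  by rewrite ed swK.
- move=> z /=; rewrite -(dsort z) /sw.
  by case: eqP => [->|_]; [rewrite dsort | case: eqP => [->|//]; rewrite dsort].
move=> z zV /=; rewrite /sw; case: eqP => // zx.
case: eqP => [zy|_]; first by move: yd; rewrite -zy map_f.
by move: zV; rewrite inE => /predU1P[zx'|/dF//]; rewrite zx' in zx.
Qed.

(** Freshness for the three finite variable lists is enough, since [rule_vars] ignores all further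
    elements of [ruleZ]. *)
Lemma fresh_variant rho (F : seq (var S)) :
  exists2 rho', variant rho rho' & forall x, rule_vars rho' x -> x \notin F.
Proof.
have [d [d_bij dsort dF]] :=
  fresh_renaming (vars (lhs rho) ++ vars (rhs rho) ++ vars (rulec rho)) F.
have sort_rename t : sort_of (rename d t) = sort_of t.
  by apply: sort_of_app_subst => x _ /=; rewrite dsort.
have Zth : d @` ruleZ rho `<=` @theory_vars S.
  by move=> _ [x /ruleZ_theory xth <-]; rewrite /theory_vars /= dsort.
have sorted : exists tau, sort_of (rename d (lhs rho)) = Some tau /\
    sort_of (rename d (rhs rho)) = Some tau.
  by rewrite !sort_rename; exact: rule_sorted.
have con : constraint (rename d (rulec rho)).
  have [cth csort] := rulec_constraint rho.
  by split; [exact: th_term_app_subst | rewrite sort_rename].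
have Zlow : [set` vars (rename d (rulec rho))] `|`
    ([set` vars (rename d (rhs rho))] `\` [set` vars (rename d (lhs rho))])
    `<=` d @` ruleZ rho.
  move=> y /=; rewrite !vars_rename => -[/mapP[x xc ->]|[/mapP[x xr ->] /negP]].
    by exists x => //; apply: (@ruleZ_lower _ rho); left.
  rewrite (mem_map (bij_inj d_bij)) => /negP xl.
  by exists x => //; apply: (@ruleZ_lower _ rho); right.
exists (CRule Zth sorted con Zlow); first by exists d.
move=> y /= [[]|]; rewrite /= vars_rename => /mapP[x xv ->];
  by apply: dF; rewrite !mem_cat xv ?orbT.
Qed.

Lemma left_linear_variant rho rho' :
  variant rho rho' -> left_linear rho -> left_linear rho'.
Proof.
move=> [d [d_bij _ _ [lE _ _]]]; rewrite /left_linear /linear lE vars_rename.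
by rewrite (map_inj_uniq (bij_inj d_bij)).
Qed.

Lemma left_value_free_variant rho rho' :
  variant rho rho' -> left_value_free rho -> left_value_free rho'.
Proof.
by move=> [d [_ _ _ [lE _ _]]]; rewrite /left_value_free lE value_free_rename.
Qed.

End Rules.

(** * Partial redexes and value instances *)

Section PartialRedexes.
Variable S : signature.
Implicit Types (A B : ecterm S) (rho : crule S) (gamma : substitution S).

Lemma notin_dom_id gamma (xs : seq (var S)) x :
  Dom gamma = [set` xs] -> x \notin xs -> gamma x = Var x.
Proof.
move=> domE /negP xxs; apply: contrapT => gx; apply: xxs.
by have : Dom gamma x by []; rewrite domE.
Qed.

Lemma partial_redex_value_interp A rho p gamma :
  partial_redex A rho p gamma ->
  exists u eta beta, [/\ value_interp A u, rule_match rho eta beta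
    & subterm u p = Some (app_subst eta (lhs rho))].
Proof.
move=> [_ _ disj domE matchE gZ /= [a a_val [[b1 [b1_val b1a b1T]]]]].
set zs := [seq z <- _ | _] => -[b2 [b2_val b2a /= b2T]].
have aX x : ecX A x -> is_val (a x) /\ res (a x) = vsort x.
  by move=> /ecX_theory /a_val.
(* Variables of [ecX A] occur in the term, hence not in the rule, so the witness for the rule's
   quantifier leaves them at [a]. *)
have b2X x : ecX A x -> b2 x = a x.
  move=> xX; apply: b2a; apply/negP; rewrite mem_filter => /andP[_ xc].
  have : set0 x; last by [].
  by rewrite -disj; split; [right | left; exact: (ecX_upper xX)].
(* The instance puts the values of [a] on [ecX A] and is the identity elsewhere, so the other
   variables trivially stay distinct variables. *)
have [|s sE] := @exists_substitution S
    [seq x <- vars (ecs A) | `[< ecX A x >]] (fun x => App (a x) [::]).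
  move=> x; rewrite mem_filter => /andP[/asboolP /aX[ax <-] _].
  by rewrite sort_of_value.
have sX x : ecX A x -> s x = App (a x) [::].
  by move=> xX; rewrite sE mem_filter asboolT //= ifT //; exact: (ecX_upper xX).
have sW x : ~ ecX A x -> s x = Var x.
  by move=> xX; rewrite sE mem_filter asboolF.
(* Off [ruleZ], [gamma x] may be any term and its evaluation need not be a value, so [b2 x] is used
   there to keep a valuation. *)
exists (app_subst s (ecs A)), (fun x => app_subst s (gamma x)),
  (fun x => if `[< ruleZ rho x >] then eval b2 (gamma x) else b2 x); split.
- exists s; split=> //.
  + by move=> x xX; exists (a x); [have [] := aX _ xX | exact: sX].
  + by move=> x [_ /sW ->]; exists x.
  + by move=> x y [_ /sW ->] [_ /sW ->] xy [].
  split.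
    by move=> x /ecX_lower xX; exists (a x); [have [] := aX _ xX | exact: sX].
  (* Every free variable of the constraint has become a value under [s], so [b1] serves as witness
     whatever [a'] is. *)
  move=> a' a'_val; exists (fun x => if x \in bvars (ecc A) then
    b1 x else a' x); split.
  + move=> x xth; case: ifP => _; [exact: b1_val | exact: a'_val].
  + by move=> x /negbTE ->.
  rewrite /= eval_app_subst -b1T; apply: eq_in_eval => x xc.
  case: ifP => [/= -> //|/negP xb].
  have xX : ecX A x by apply: ecX_lower.
  rewrite sX //= interp_val; last by have [] := aX _ xX.
  by rewrite b1a //; apply/negP.
- split.
  + move=> x _; rewrite sort_of_app_subst ?sfun_sort // => y _.
    exact: sfun_sort.
  + move=> x xth; case: asboolP => [xZ|_]; last exact: b2_val.
    have [xl|xl] := boolP (x \in vars (lhs rho)); last first.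
      by rewrite (notin_dom_id domE xl); exact: b2_val.
    have [[c c_val gx]|[y yX gx]] := gZ x xl xZ.
      rewrite gx eval_value //; split=> //; exact: substitution_value_res gx.
    rewrite gx /= b2X //; have [ay ->] := aX _ yX; split=> //.
    by have := sfun_sort gamma x; rewrite gx => -[].
  + move=> x xl xZ; rewrite asboolT //; have [[c c_val ->]|[y yX ->]] := gZ x xl xZ.
      by rewrite /= interp_val.
    by rewrite /= sX // b2X.
  rewrite -b2T eval_app_subst; apply: eq_in_eval => x xc.
  by rewrite asboolT //; apply: (@ruleZ_lower _ rho); left.
by rewrite (subterm_app_subst _ matchE) app_substA.
Qed.

Lemma value_interp_partial_redex A rho u p eta beta :
  (forall x, rule_vars rho x -> x \notin vars (ecs A) ++ vars (body (ecc A))) ->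
  left_linear rho -> left_value_free rho ->
  value_interp A u -> rule_match rho eta beta ->
  subterm u p = Some (app_subst eta (lhs rho)) ->
  exists gamma, partial_redex A rho p gamma.
Proof.
move=> fresh lin vfree [s [sX sW _ [_ s_valid] ->]].
move=> [eta_sort beta_val etaZ betaT] sp.
have disj : rule_vars rho `&`
    ([set` vars (ecs A)] `|` [set` vars (body (ecc A))]) = set0.
  apply/seteqP; split=> // x [/fresh]; rewrite mem_cat negb_or.
  by move=> /andP[/negP xs /negP xc] [].
have sP : {in vars (ecs A), forall x, var_or_value (s x)}.
  move=> x xs; have [/sX|xX] := pselect (ecX A x); first by right.
  by left; apply: sW.
have [w wp wE] := subterm_app_substE sP sp.
have wsub := vars_subterm wp.
have [h wh] : exists h, w = app_subst h (lhs rho).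
  by apply: value_free_match (esym wE) => // x /wsub; exact: sP.
(* Comparing the two instances of the left-hand side shows that [eta] is [h] followed by [s]. *)
have shE : {in vars (lhs rho), forall x, app_subst s (h x) = eta x}.
  by apply: app_subst_inj_in; rewrite wE wh app_substA.
have hsub x y : x \in vars (lhs rho) -> y \in vars (h x) -> y \in vars (ecs A).
  by move=> xl yh; apply: wsub; rewrite wh; apply/mem_vars_app_subst; exists x.
have lfresh x : x \in vars (lhs rho) -> x \notin vars (ecs A).
  move=> xl; have : rule_vars rho x by left; left.
  by move=> /fresh; rewrite mem_cat negb_or => /andP[].
have [|gamma gE] := @exists_substitution S (vars (lhs rho)) h.
  move=> x xl; rewrite -eta_sort // -shE // sort_of_app_subst // => y _.
  exact: sfun_sort.
(* At a logical variable, [h x] becomes a value under [s]: it is that value itself, or a variable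
   that must lie in [ecX A], as [s] sends the other variables of the term to variables. *)
have gZ x : x \in vars (lhs rho) -> ruleZ rho x ->
    [/\ is_val (beta x), res (beta x) = vsort x
      & gamma x = App (beta x) [::] \/ exists y,
        [/\ ecX A y, gamma x = Var y & s y = App (beta x) [::]]].
  move=> xl xZ; have [bx bxs] := beta_val x (ruleZ_theory xZ).
  split=> //; have := shE x xl; have := hsub x ^~ xl; rewrite etaZ // gE xl.
  case: (h x) => [y|c ts] /= ysub; last first.
    by case=> -> ; case: ts {ysub} => //; left.
  move=> sy; right; exists y; split=> //; apply: contrapT => yX.
  have [|z] := sW y; last by rewrite sy.
  by split=> //; apply: ysub; rewrite mem_head.
have [a0 a0_val] := exists_valuation S.
(* Evaluating the value [s x] extracts its constant; off [ecX A] any valuation will do. *)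
pose a x := if `[< ecX A x >] then eval a0 (s x) else a0 x.
have sa x : ecX A x -> is_val (a x) /\ s x = App (a x) [::].
  move=> xX; rewrite /a asboolT //; have [c c_val ->] := sX x xX.
  by rewrite eval_value.
have a_val : valuation a.
  move=> x xth; have [xX|xX] := pselect (ecX A x).
    have [ax sx] := sa x xX; split=> //; exact: substitution_value_res sx.
  by rewrite /a asboolF //; exact: a0_val.
have [b1 [b1_val b1a /= b1T]] := s_valid a a_val.
have b1P : holds a (formula_of (ecc A)).
  exists b1; split=> //=; rewrite -b1T eval_app_subst; apply: eq_in_eval => x xc.
  case: ifP => [//|/negbT xb]; rewrite b1a //.
  have xX : ecX A x by apply: ecX_lower; split=> //; apply/negP.
  by have [ax ->] := sa x xX; rewrite /= interp_val.
exists gamma; split=> //.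
- by exists a.
(* [h x] has its variables in the term, where [x] is fresh; so [gamma] really moves every variable
   of the left-hand side. *)
- apply/seteqP; split=> x; rewrite /Dom /= gE; case: ifP => // xl _ hx.
  by have := lfresh x xl; rewrite (hsub x x) // hx mem_head.
- by rewrite wp wh; congr Some; apply: eq_in_app_subst => x xl; rewrite gE xl.
- move=> x xl xZ; have [bx _ [gx|[y [yX gx _]]]] := gZ x xl xZ.
    by left; exists (beta x).
  by right; exists y.
move=> zs; exists a => //; split=> //.
(* The two valuations are glued: [beta] on the variables private to the rule's constraint, [a] on
   those of the constrained term. *)
exists (fun x => if x \in zs then beta x else a x); split.
- by move=> x xth; case: ifP => _; [exact: beta_val | exact: a_val].
- by move=> x /negbTE ->.
rewrite /= eval_app_subst -betaT; apply: eq_in_eval => x xc.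
have [xl|xl] := boolP (x \in vars (lhs rho)); last first.
  by rewrite gE (negbTE xl) /= ifT // mem_filter xl.
have xZ : ruleZ rho x by apply: (@ruleZ_lower _ rho); left.
have [bx _ [->|[y [yX -> sy]]]] := gZ x xl xZ; first by rewrite eval_value.
(* Here [a y] is the constant of [s y], that is [beta x]; freshness keeps [y] out of [zs]. *)
rewrite /= ifN; first by have [_] := sa y yX; rewrite sy => -[].
rewrite mem_filter negb_and; apply/orP; right; apply/negP => yc.
have : rule_vars rho y by right.
by move=> /fresh; rewrite mem_cat (ecX_upper yX : y \in _).
Qed.

(** The contractum is prescribed by the step; what has to be checked is that it meets the side
    conditions packed into [ecterm]. *)
Lemma partial_redex_step A rho p gamma :
  partial_redex A rho p gamma -> exists B, partial_step_at rho p gamma A B.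
Proof.
move=> redex; have [_ _ disj domE matchE gZ _] := redex.
set t := replace (ecs A) p (app_subst gamma (rhs rho)).
set psi := App (s_and S) [:: body (ecc A); app_subst gamma (rulec rho)].
have Zc x : x \in vars (rulec rho) -> ruleZ rho x.
  by move=> xc; apply: (@ruleZ_lower _ rho); left.
have gsort u : sort_of (app_subst gamma u) = sort_of u.
  by apply: sort_of_app_subst => x _; exact: sfun_sort.
have gid x : x \notin vars (lhs rho) -> gamma x = Var x.
  exact: notin_dom_id domE.
have gsub x y : x \in vars (lhs rho) -> y \in vars (gamma x) ->
    y \in vars (ecs A).
  move=> xl yx; apply: (vars_subterm matchE).
  by apply/mem_vars_app_subst; exists x.
(* [gamma] fixes variables outside the left-hand side and maps the others to subterms of the source,
   so only extra variables are new. *)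
have t_vars x : x \in vars t -> x \in vars (ecs A) \/ ExVar rho x.
  move=> /vars_replace[|/mem_vars_app_subst[y yr xy]]; first by left.
  have [yl|yl] := boolP (y \in vars (lhs rho)); first by left; exact: gsub xy.
  move: xy; rewrite gid // inE => /eqP ->; right.
  by split=> //; apply/negP.
have X_theory : ExVar rho `|` (ecX A `&` [set` vars t]) `<=` @theory_vars S.
  move=> x [xr|[/ecX_theory//]].
  by apply: (@ruleZ_theory _ rho); apply: ruleZ_lower; right.
have t_sorted : sort_of t <> None.
  have [tau [lE rE]] := rule_sorted rho.
  rewrite (sort_of_replace matchE); first exact: ecs_sorted.
  by rewrite !gsort lE rE.
have psi_con : constraint psi.
  have [phi_th phi_sort] := body_constraint (ecc A).
  have [pi_th pi_sort] := rulec_constraint rho.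
  have [and_th and_ar and_res] := s_and_th S.
  split; last by rewrite /= gsort phi_sort pi_sort and_ar eqxx and_res.
  rewrite /= and_th phi_th andbT th_term_app_subst // => x /Zc xZ.
  have [xl|/gid ->//] := boolP (x \in vars (lhs rho)).
  have [[c c_val ->]|[y _ ->]] // := gZ x xl xZ.
  by rewrite /= val_th.
have bv_sub : {subset [seq x <- vars psi | x \notin vars t] <= vars psi}.
  by move=> x; rewrite mem_filter => /andP[].
pose c := ExConstraint psi_con bv_sub.
have bvE : [set` bvars c] = [set` vars psi] `\` [set` vars t].
  apply/seteqP; split=> x; rewrite /= mem_filter; first by move=> /andP[/negP].
  by move=> [-> /negP ->].
(* A free variable of [psi] that occurs in the source and comes from the old constraint was not
   bound there, by [ec_bound]. If it comes from the rule's constraint, it is an image under [gamma]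
   in [ecX A], since disjointness excludes a variable fixed by [gamma]. *)
have X_lower : FVar c `<=` ExVar rho `|` (ecX A `&` [set` vars t]).
  move=> x [/= xpsi xb].
  have xt : x \in vars t.
    by apply: contrapT => /negP xt; apply: xb => /=; rewrite mem_filter xt.
  have [xs|] := t_vars x xt; last by left.
  right; split=> //; move: xpsi; rewrite cats0 mem_cat => /orP[xc|].
    apply: ecX_lower; split=> // xbA; have : set0 x; last by [].
    by rewrite -(ec_bound A).
  move=> /mem_vars_app_subst[y yc].
  have [yl|yl] := boolP (y \in vars (lhs rho)).
    have [[d _ ->]|[z zX ->]] // := gZ y yl (Zc y yc).
    by rewrite inE => /eqP ->.
  rewrite gid // inE => /eqP xy; have : set0 x; last by [].
  by rewrite -disj xy; split; [right | left; rewrite -xy].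
have X_upper : ExVar rho `|` (ecX A `&` [set` vars t]) `<=` [set` vars t].
  move=> x [[xr /negP xl]|[]//]; apply: (vars_replace_sub matchE).
  by apply/mem_vars_app_subst; exists x => //; rewrite gid // mem_head.
have bound : [set` bvars c] `&` [set` vars t] = set0.
  by rewrite bvE; apply/seteqP; split=> // x [[]].
by exists (EcTerm X_theory t_sorted X_lower X_upper bound).
Qed.

End PartialRedexes.

Theorem theorem6p3 (S : signature) (R : set (crule S)) (A : ecterm S)
    (lctrsR : lctrs R)
    (R_left_value_free : forall rho : crule S, R rho -> left_value_free rho) :
  normal_form (partial_step R) A <->
  (forall u : term S, value_interp A u ->
     normal_form (rstep (lctrs_interp R)) u).
Proof.
split=> [nf u uA [v [l [r [p [theta [[rho Rrho lr] up _]]]]]] | nf [B]].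
  have [eta [beta [m lE]]] := rule_interp_match theta lr.
  (* Ground-level rewriting uses [rho] itself, whereas a partial redex needs a rule disjoint from
     [A]; the matching data is carried over to a fresh variant. *)
  have [rho' var_rho fresh] :=
    fresh_variant rho (vars (ecs A) ++ vars (body (ecc A))).
  have [eta' [beta' [m' lE']]] := rule_match_variant (variant_sym var_rho) m.
  have [gamma redex] : exists gamma, partial_redex A rho' p gamma.
    apply: (value_interp_partial_redex fresh _ _ uA m').
    - by apply: left_linear_variant var_rho _; exact: lctrsR.1.
    - by apply: left_value_free_variant var_rho _; exact: R_left_value_free.
    by rewrite lE' -lE.
  have [B stepB] := partial_redex_step redex.
  by apply: nf; exists B, rho, rho', p, gamma.
move=> [rho [rho' [p [gamma [Rrho var_rho [redex _ _ _ _]]]]]].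
have [u [eta [beta [uA m up]]]] := partial_redex_value_interp redex.
(* The data is moved back from the variant to the rule [rho] of [R], whose interpretation supplies
   the rewrite step. *)
have [eta' [beta' [m' lE]]] := rule_match_variant var_rho m.
have [l [r [theta [lr lE']]]] := rule_match_interp m'.
apply: (nf u uA); exists (replace u p (app_subst theta r)), l, r, p, theta.
by split=> //; [exists rho | rewrite up -lE -lE'].
Qed.
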